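(* Let $(\mu(a,0,A,\eta),J,g)$ be a $2n$-dimensional Hermitian almost nilpotent Lie algebra; thus $\eta\neq0$, $A^*\eta=a\eta$, $[A,J|_{\mathfrak{k}_1}]=0$ and $\eta\in\Lambda^{1,1}\mathfrak{k}_1^*$. Then it is SKT if and only if $$\eta^2=\eta\wedge A^*\omega,\qquad (aA+A^2+A^tA)^*\omega=2a\eta.$$ In particular, it is Kähler if and only if $\eta=A^*\omega$.
   Context: On $\mathbb{R}^{2n}$ ($n\geq 2$) with standard basis $\{e_1,\dots,e_{2n}\}$ let $g$ be the standard inner product, let $Je_1=e_{2n}$, $Je_{2l}=e_{2l+1}$ for $l=1,\dots,n-1$, and let $\mathfrak{k}_1=\mathbb{R}\langle e_2,\dots,e_{2n-1}\rangle$. For $a\in\mathbb{R}$, $A\in\mathfrak{gl}(\mathfrak{k}_1)$, $0\ne\eta\in\Lambda^2\mathfrak{k}_1^*$ with $A^*\eta=a\eta$, $\mu(a,0,A,\eta)$ is the Lie algebra structure on $\mathbb{R}^{2n}$ with brackets $[e_{2n},e_1]=ae_1$, $[e_{2n},X]=AX$, $[X,Y]=-\eta(X,Y)e_1$, $[e_1,X]=0$ for $X,Y\in\mathfrak{k}_1$; $J$ is integrable exactly when $[A,J|_{\mathfrak{k}_1}]=0$ and $\eta\in\Lambda^{1,1}\mathfrak{k}_1^*$ (i.e. $\eta(J\cdot,J\cdot)=\eta$). The Lie algebra is almost nilpotent with nilradical $\mathfrak{n}=\mathbb{R}\langle e_1,\dots,e_{2n-1}\rangle$, whose commutator is $\mathbb{R}e_1$.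 Here $\omega=g(J\cdot,\cdot)$; for an endomorphism $C$ of $\mathfrak{k}_1$ and a 2-form $\sigma$ on $\mathfrak{k}_1$, $(C^*\sigma)(X,Y)=\sigma(CX,Y)+\sigma(X,CY)$, and $C^*\omega$ means $C^*(\omega|_{\mathfrak{k}_1})$; $A^t$ is the $g$-transpose; $\eta^2=\eta\wedge\eta$. Exterior derivatives are those of the Chevalley–Eilenberg complex (left-invariant forms), and $d^c=i(\overline\partial-\partial)$. The Hermitian structure is SKT if $dd^c\omega=0$ and Kähler if $d\omega=0$. *)

(* Defs.v *)
From mathcomp Require Import all_boot all_order perm all_algebra.
From mathcomp Require Import complex.
From mathcomp Require Import reals.

Set Implicit Arguments.
Unset Strict Implicit.
Unset Printing Implicit Defensive.

Import GRing.Theory.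
Local Open Scope ring_scope.

(* A k-form on K^m is a function of the m x k matrix whose columns are its
   k arguments; being multilinear and alternating is [exterior_form]. *)
Definition kform (K : Type) (m k : nat) := 'M[K]_(m, k) -> K.

Section Forms.
Variables (K : numFieldType) (m : nat).

Definition exterior_form (k : nat) (alpha : kform K m k) : Prop :=
  (forall (j : 'I_k) (c : K) (M N P : 'M[K]_(m, k)),
      col j M = c *: col j N + col j P ->
      col' j M = col' j N -> col' j M = col' j P ->
      alpha M = c * alpha N + alpha P) /\
  (forall (i j : 'I_k) (M : 'M[K]_(m, k)),
      i != j -> col i M = col j M -> alpha M = 0).

Definition wedge (p q : nat) (alpha : kform K m p) (beta : kform K m q) :
    kform K m (p + q) := fun M =>
  ((p`! * q`!)%N%:R)^-1 *
  \sum_(s : 'S_(p + q))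
     (-1) ^+ s * alpha (lsubmx (col_perm s M)) * beta (rsubmx (col_perm s M)).

Definition act2 (C : 'M[K]_m) (sigma : kform K m 2) : kform K m 2 := fun M =>
  sigma (row_mx (C *m col 0 M) (col 1 M)) +
  sigma (row_mx (col 0 M) (C *m col 1 M)).

Definition std_form (x y : 'cV[K]_m) : K := (x^T *m y) 0 0.

(* Over R this is omega = g(J., .); over R[i], with the matrix J complexified,
   it is the complex multilinear extension of omega. *)
Definition fund_form (J : 'M[K]_m) : kform K m 2 :=
  fun M => std_form (J *m col 0 M) (col 1 M).

(* d alpha (x_0, .., x_k) =
   \sum_(i < j) (-1)^(i+j) alpha ([x_i, x_j], .., no x_i, .., no x_j, ..).
   Here i : 'I_k.+1 with i < j, so that lift j i is i seen in 'I_k.+2. *)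
Definition ce_diff (bracket : 'cV[K]_m -> 'cV[K]_m -> 'cV[K]_m) (k : nat) :
    kform K m k -> kform K m k.+1 :=
  match k with
  | 0 => fun _ _ => 0
  | k'.+1 => fun alpha M =>
      \sum_(j < k'.+2) \sum_(i < k'.+1 | (i < j)%N)
        (-1) ^+ (i + j) *
        alpha (row_mx (bracket (col (lift j i) M) (col j M))
                      (col' i (col' j M)))
  end.

End Forms.

Section HermitianLieAlgebra.
Variables (R : realType) (m : nat).
Variables (bracket : 'cV[R]_m -> 'cV[R]_m -> 'cV[R]_m) (J : 'M[R]_m).

Definition cplx_mx (p q : nat) (M : 'M[R]_(p, q)) : 'M[R[i]]_(p, q) :=
  map_mx (real_complex R) M.

Definition cplx_bracket (z w : 'cV[R[i]]_m) : 'cV[R[i]]_m :=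
  let x := map_mx (@complex.Re R) z in let y := map_mx (@complex.Im R) z in
  let u := map_mx (@complex.Re R) w in let v := map_mx (@complex.Im R) w in
  cplx_mx (bracket x u - bracket y v) +
  'i%C *: cplx_mx (bracket x v + bracket y u).

Local Notation d := (ce_diff cplx_bracket).

(* Projections of the complexification onto the i- and (-i)-eigenspaces of J *)
Definition proj10 : 'M[R[i]]_m := 2^-1 *: (1%:M - 'i%C *: cplx_mx J).
Definition proj01 : 'M[R[i]]_m := 2^-1 *: (1%:M + 'i%C *: cplx_mx J).

(* The component of type (p, k - p) of a k-form: expand each argument as the
   sum of its (1,0)- and (0,1)-parts and keep the terms with exactly p
   arguments of type (1,0). *)
Definition bidegree (p k : nat) (alpha : kform R[i] m k) : kform R[i] m k :=
  fun M => \sum_(S : {set 'I_k} | #|S| == p)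
    alpha (\matrix_(i, j) (if j \in S then proj10 *m M else proj01 *m M) i j).

Definition del (k : nat) (alpha : kform R[i] m k) : kform R[i] m k.+1 :=
  fun M => \sum_(p < k.+1) bidegree p.+1 (d (bidegree p alpha)) M.

Definition delbar (k : nat) (alpha : kform R[i] m k) : kform R[i] m k.+1 :=
  fun M => \sum_(p < k.+1) bidegree p (d (bidegree p alpha)) M.

Definition dc (k : nat) (alpha : kform R[i] m k) : kform R[i] m k.+1 :=
  fun M => 'i%C * (delbar alpha M - del alpha M).

Definition SKT : Prop := d (dc (fund_form (cplx_mx J))) =1 (fun _ => 0).

Definition Kahler : Prop := ce_diff bracket (fund_form J) =1 (fun _ => 0).

End HermitianLieAlgebra.

(* R^{2n} is split as R e_1 + k_1 + R e_{2n}. *)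
Definition dim_k1 (n : nat) : nat := n.-1.*2.
Definition dim_g (n : nat) : nat := 1 + (dim_k1 n + 1).

Lemma dim_gE (n : nat) : (0 < n)%N -> dim_g n = n.*2.
Proof. by case: n => // n _; rewrite /dim_g /dim_k1 /= addn1. Qed.

Section Mu.
Variables (R : realType) (n : nat).
Local Notation k1 := 'cV[R]_(dim_k1 n).
Local Notation g := 'cV[R]_(dim_g n).

Definition vec (s : R) (X : k1) (t : R) : g := col_mx s%:M (col_mx X t%:M).
Definition e1_coord (x : g) : R := usubmx x 0 0.
Definition k1_part (x : g) : k1 := usubmx (dsubmx x).
Definition e2n_coord (x : g) : R := dsubmx (dsubmx x) 0 0.

(* J e_{2l} = e_{2l+1}, J e_{2l+1} = - e_{2l} on k_1; the row or column of
   index j : 'I_(dim_k1 n) corresponds to the basis vector e_{j+2}. *)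
Definition J_k1 : 'M[R]_(dim_k1 n) :=
  \matrix_(i, j) if ~~ odd j && (i == j.+1 :> nat) then 1
                 else if odd j && (j == i.+1 :> nat) then -1 else 0.

(* Moreover J e_1 = e_{2n} and J e_{2n} = - e_1. *)
Definition J_std : 'M[R]_(dim_g n) :=
  block_mx 0 (row_mx 0 (-1)%:M)
           (col_mx 0 1%:M) (block_mx J_k1 0 0 0).

Definition restr_k1 (k : nat) (alpha : kform R (dim_g n) k) :
    kform R (dim_k1 n) k :=
  fun M => alpha (col_mx 0 (col_mx M 0)).

Definition omega_k1 : kform R (dim_k1 n) 2 := restr_k1 (fund_form J_std).

(* mu(a, 0, A, eta) *)
Definition mu (a : R) (A : 'M[R]_(dim_k1 n)) (eta : kform R (dim_k1 n) 2)
    (x y : g) : g :=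
  vec (a * (e2n_coord x * e1_coord y - e2n_coord y * e1_coord x)
         - eta (row_mx (k1_part x) (k1_part y)))
      (e2n_coord x *: (A *m k1_part y) - e2n_coord y *: (A *m k1_part x))
      0.

Lemma vecK (s t : R) (X : k1) :
  (e1_coord (vec s X t) = s) * (k1_part (vec s X t) = X) *
  (e2n_coord (vec s X t) = t).
Proof.
by rewrite /e1_coord /k1_part /e2n_coord /vec !col_mxKd !col_mxKu !mxE eqxx.
Qed.

Lemma mu_table (a : R) (A : 'M[R]_(dim_k1 n)) (eta : kform R (dim_k1 n) 2)
    (X Y : k1) : exterior_form eta ->
  [/\ mu a A eta (vec 0 0 1) (vec 1 0 0) = vec a 0 0,
      mu a A eta (vec 0 0 1) (vec 0 X 0) = vec 0 (A *m X) 0,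
      mu a A eta (vec 0 X 0) (vec 0 Y 0) = vec (- eta (row_mx X Y)) 0 0
    & mu a A eta (vec 1 0 0) (vec 0 X 0) = vec 0 0 0].
Proof.
move=> [mlin alt].
have col01 (Z T : k1) : (col 0 (row_mx Z T : 'M_(_, 1 + 1)) = Z) *
                        (col 1 (row_mx Z T : 'M_(_, 1 + 1)) = T).
  split; apply/colP => i; rewrite !mxE; case: splitP => j;
    by rewrite (ord1 j).
have eta0X (Z : k1) : eta (row_mx (0 : k1) Z) = 0.
  set M : 'M_(_, 1 + 1) := row_mx _ _.
  have := mlin 0 1 M M M; rewrite col01 scaler0 addr0 mul1r.
  by move=> /(_ erefl erefl erefl) etaM; apply: (addrI (eta M)); rewrite addr0.
split; rewrite /mu !vecK.
all: by rewrite !(eta0X, mulmx0, scale0r, scale1r, scaler0, mulr0, mul0r, mulr1,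
  subr0, sub0r, oppr0).
Qed.

Lemma J_std_vec (s t : R) (X : k1) :
  J_std *m vec s X t = vec (- t) (J_k1 *m X) s.
Proof.
rewrite /J_std /vec mul_block_col mul_row_col mul_col_mx mul_block_col.
by rewrite !mul0mx !add0r add_col_mx !addr0 !mul1mx !add0r -scalar_mxM mulN1r.
Qed.

End Mu.

Arguments omega_k1 : clear implicits.

(* Main.v *)
(* With theta = e^{2n} and sigma = eta - A^*omega, d omega = theta /\ sigma,
   whence the Kahler criterion. As omega and sigma are of type (1,1),
   d^c omega = - (theta o J) /\ sigma = - e^1 /\ sigma. Moreover
   d e^1 = eta - a e^{2n} /\ e^1 and d sigma = - e^{2n} /\ A^*sigma, so that
     - d d^c omega = eta /\ sigma + e^1 /\ e^{2n} /\ (a sigma + A^*sigma),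
   where both terms must vanish. Since A^*eta = a eta and, A commuting with J,
   (A^t A)^*omega = 2 omega(A ., A .), the vanishing of a sigma + A^*sigma is
   (a A + A^2 + A^t A)^*omega = 2 a eta. All 2-forms on k_1 are encoded by
   their Gram matrices, over a field covering both R and R[i]. *)
Require Import Defs.
From mathcomp Require Import all_boot all_order perm all_algebra.
From mathcomp Require Import complex.
From mathcomp Require Import reals.
From mathcomp Require Import ring zify.

Set Implicit Arguments.
Unset Strict Implicit.
Unset Printing Implicit Defensive.

Import GRing.Theory.
Local Open Scope ring_scope.

(* Columns indexed by [nat], so that [lift] and [bump] compute on explicit
   indices; an out-of-range index yields column 0. *)
Definition colv (K : Type) (m n : nat) (M : 'M[K]_(m, n.+1)) (k : nat) :
  'cV[K]_m := col (inord k) M.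

(** * Columns of a matrix, and the differential of 2- and 3-forms *)

Section Columns.
Variables (K : numFieldType) (m : nat).
Implicit Types (x y z : 'cV[K]_m).

Lemma col_colv (n : nat) (M : 'M[K]_(m, n.+1)) (j : 'I_n.+1) :
  col j M = colv M j.
Proof. by rewrite /colv inord_val. Qed.

Lemma colv_row_mx0 (n : nat) x (N : 'M[K]_(m, n)) :
  @colv K m n (row_mx x N) 0 = x.
Proof.
apply/colP => i; rewrite /colv.
have -> : inord 0 = lshift n (0 : 'I_1) by apply: val_inj; rewrite /= inordK.
rewrite mxE; exact: row_mxEl.
Qed.

Lemma colv_row_mxS (n : nat) x (N : 'M[K]_(m, n.+1)) (k : nat) :
  (k < n.+1)%N -> @colv K m n.+1 (row_mx x N) k.+1 = colv N k.
Proof.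
move=> lt_kn; apply/colP => i; rewrite /colv.
have -> : inord k.+1 = rshift 1 (inord k : 'I_n.+1).
  by apply: val_inj; rewrite /= !inordK.
by rewrite [LHS]mxE [RHS]mxE; exact: row_mxEr.
Qed.

Lemma colv_col' (n : nat) (M : 'M[K]_(m, n.+2)) (j : 'I_n.+2) (k : nat) :
  (k < n.+1)%N -> colv (col' j M) k = colv M (bump j k).
Proof.
move=> lt_kn; have lt_bump : (bump j k < n.+2)%N.
  by rewrite /bump; case: (leqP j k) => _; [exact: lt_kn | exact: leqW].
apply/colP => i; rewrite !mxE; congr (M _ _); apply: val_inj.
by rewrite /= !inordK.
Qed.

Definition form2 (f : 'cV[K]_m -> 'cV[K]_m -> K) : kform K m 2 :=
  fun M => f (colv M 0) (colv M 1).

Definition form3 (f : 'cV[K]_m -> 'cV[K]_m -> 'cV[K]_m -> K) : kform K m 3 :=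
  fun M => f (colv M 0) (colv M 1) (colv M 2).

Arguments form2 : simpl never.
Arguments form3 : simpl never.

Lemma form2_row_mx f x (N : 'M[K]_(m, 1)) :
  form2 f (row_mx x N) = f x (colv N 0).
Proof. by rewrite /form2 colv_row_mx0 colv_row_mxS. Qed.

Lemma form3_row_mx f x (N : 'M[K]_(m, 2)) :
  form3 f (row_mx x N) = f x (colv N 0) (colv N 1).
Proof. by rewrite /form3 colv_row_mx0 !colv_row_mxS. Qed.

Variable bracket : 'cV[K]_m -> 'cV[K]_m -> 'cV[K]_m.

Lemma eq_ce_diff (k : nat) (alpha beta : kform K m k) :
  alpha =1 beta -> ce_diff bracket alpha =1 ce_diff bracket beta.
Proof.
case: k alpha beta => [//|k] alpha beta eq_ab M /=.
by apply: eq_bigr => j _; apply: eq_bigr => i _; rewrite eq_ab.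
Qed.

Lemma eq_ce_diff_bracket bracket' (k : nat) (alpha : kform K m k) :
  (forall x y, bracket x y = bracket' x y) ->
  ce_diff bracket alpha =1 ce_diff bracket' alpha.
Proof.
case: k alpha => [//|k] alpha eq_br M /=.
by apply: eq_bigr => j _; apply: eq_bigr => i _; rewrite eq_br.
Qed.

Lemma ce_diff_form2 f (M : 'M[K]_(m, 3)) :
  ce_diff bracket (form2 f) M =
  - f (bracket (colv M 0) (colv M 1)) (colv M 2)
  + f (bracket (colv M 0) (colv M 2)) (colv M 1)
  - f (bracket (colv M 1) (colv M 2)) (colv M 0).
Proof.
(* [big_mkcond] turns the constraint i < j into a conditional summand, which computation decides
   once the ordinals are explicit. *)
rewrite /ce_diff; under eq_bigr do rewrite big_mkcond.
rewrite !(big_ord_recl, big_ord0) /=.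
rewrite !form2_row_mx !colv_col' //= !col_colv /= /bump /=.
rewrite !(add0n, addn0, add1n) /= !(exprS, expr0).
ring.
Qed.

Lemma ce_diff_form3 f (M : 'M[K]_(m, 4)) :
  ce_diff bracket (form3 f) M =
  - f (bracket (colv M 0) (colv M 1)) (colv M 2) (colv M 3)
  + f (bracket (colv M 0) (colv M 2)) (colv M 1) (colv M 3)
  - f (bracket (colv M 0) (colv M 3)) (colv M 1) (colv M 2)
  - f (bracket (colv M 1) (colv M 2)) (colv M 0) (colv M 3)
  + f (bracket (colv M 1) (colv M 3)) (colv M 0) (colv M 2)
  - f (bracket (colv M 2) (colv M 3)) (colv M 0) (colv M 1).
Proof.
rewrite /ce_diff; under eq_bigr do rewrite big_mkcond.
rewrite !(big_ord_recl, big_ord0) /=.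
rewrite !form3_row_mx !colv_col' //= !col_colv /= /bump /=.
rewrite !(add0n, addn0, add1n) /= !(exprS, expr0).
ring.
Qed.

End Columns.

(** * Sums over permutations, and the wedge product of two 2-forms *)

Section PermSums.
Variables (V : nmodType).

(** A permutation amounts to the image [j] of 0 together with a permutation of the remaining n
    points. The map [f] back is injective, and (n+1)! = (n+1) n! makes it bijective. *)
Lemma sum_perm_lift (n : nat) (F : 'S_n.+1 -> V) :
  \sum_s F s = \sum_j \sum_(t : 'S_n) F (lift_perm 0 j t).
Proof.
pose f (u : 'I_n.+1 * 'S_n) := lift_perm 0 u.1 u.2.
have f_inj : injective f.
  move=> [j s] [k t] /permP eq_f; have := eq_f 0.
  rewrite /f /= !lift_perm_id => eq_jk; rewrite -{}eq_jk in eq_f *.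
  congr (_, _); apply/permP => i; apply: (@lift_inj _ j).
  by have := eq_f (lift 0 i); rewrite /f /= !lift_perm_lift.
have f_bij : bijective f.
  apply: inj_card_bij f_inj _.
  by rewrite card_prod !card_Sn card_ord factS.
by rewrite (reindex f (onW_bij _ f_bij)) -(pair_bigA _ (fun j t => F (f (j, t)))).
Qed.

Lemma sum_perm0 (F : 'S_0 -> V) : \sum_s F s = F 1%g.
Proof.
by rewrite (big_pred1 (1%g : 'S_0)) // => s; symmetry; apply/eqP/permP; case.
Qed.

End PermSums.

(** The 24 permutations fall into six shuffles, each counted 2! 2! = 4 times because [f] and [g] are
    skew; this cancels the normalising factor. *)
Lemma wedge_form22 (K : numFieldType) (m : nat) (f g : 'cV[K]_m -> 'cV[K]_m -> K)
    (M : 'M[K]_(m, 4)) :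
  (forall x y, f y x = - f x y) -> (forall x y, g y x = - g x y) ->
  let x := colv M 0 in let y := colv M 1 in
  let z := colv M 2 in let w := colv M 3 in
  wedge (form2 f) (form2 g) M =
  f x y * g z w - f x z * g y w + f x w * g y z
  + f y z * g x w - f y w * g x z + f z w * g x y.
Proof.
move=> fN gN x y z w.
(* Indices written as iterated lifts of 0 let [lift_perm_lift] evaluate the permutations that
   [sum_perm_lift] produces. *)
have expandE (s : 'S_4) :
  (-1) ^+ s * form2 f (@lsubmx _ _ 2 2 (col_perm s M)) *
    form2 g (@rsubmx _ _ 2 2 (col_perm s M)) =
  (-1) ^+ s * f (colv M (s 0)) (colv M (s (lift 0 0))) *
    g (colv M (s (lift 0 (lift 0 0))))
      (colv M (s (lift 0 (lift 0 (lift 0 0))))).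
  rewrite /form2 /colv !inord_val; congr (_ * f _ _ * g _ _);
    apply/colP => i; rewrite !mxE; congr (M _ (s _)); apply: val_inj;
    by rewrite /= inordK.
rewrite /wedge (eq_bigr _ (fun s _ => expandE s)) {expandE}.
rewrite !(sum_perm_lift, big_ord_recl, big_ord0, sum_perm0).
rewrite !(lift_perm_lift, lift_perm_id, odd_lift_perm, odd_perm1) /= /bump /=.
rewrite !(add0n, addn0, add1n) /=.
rewrite -/x -/y -/z -/w.
(* Arguments are put in the order x, y, z, w, so that terms equal up to sign share their atoms. *)
rewrite !(fN x y, fN x z, fN x w, fN y z, fN y w, fN z w).
rewrite !(gN x y, gN x z, gN x w, gN y z, gN y w, gN z w).
rewrite /bump /=.
rewrite (_ : (2`! * 2`!)%:R = 4) // !(expr0, expr1).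
by field.
Qed.

(** * Sums over subsets of prescribed cardinality *)

Section SubsetSums.
Variables (V : nmodType) (T : finType) (F : {set T} -> V).

Lemma sum_set_card0 : \sum_(S : {set T} | #|S| == 0%N) F S = F set0.
Proof. by rewrite (big_pred1 set0) // => S; rewrite cards_eq0. Qed.

Lemma sum_set_cardT : \sum_(S : {set T} | #|S| == #|T|) F S = F setT.
Proof.
rewrite (big_pred1 setT) // => S /=.
by rewrite eqEcard subsetT cardsT eqn_leq max_card.
Qed.

Lemma sum_set_card1 : \sum_(S : {set T} | #|S| == 1%N) F S = \sum_x F [set x].
Proof.
rewrite -[RHS](big_imset F (in2W (@set1_inj T))) /=.
apply: eq_bigl => S; apply/cards1P/imsetP => [[x ->]|[x _ ->]];
  by exists x.
Qed.

End SubsetSums.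

(** Complementation reduces this to singletons. For a 3-form it enumerates the choices of two
    arguments of type (1,0). *)
Lemma sum_set_cardC1 (V : nmodType) (n : nat) (F : {set 'I_n.+1} -> V) :
  \sum_(S : {set 'I_n.+1} | #|S| == n) F S = \sum_j F [set~ j].
Proof.
rewrite (reindex_inj (@setC_inj 'I_n.+1)) -(sum_set_card1 (fun S => F (~: S))) /=.
apply: eq_bigl => S; rewrite -(eqn_add2l #|S|) cardsC card_ord.
by rewrite (eqn_add2r n 1) eq_sym.
Qed.

(** * Forms of type (1,1) for an abstract complex structure *)

Section ComplexStructure.
Variables (K : numFieldType) (V : lmodType K) (i : K) (J P Q : V -> V).

Definition lin (f : V -> K) : Prop :=
  forall c x y, f (c *: x + y) = c * f x + f y.

Definition bilin (f : V -> V -> K) : Prop :=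
  (forall y, lin (f^~ y)) /\ (forall x, lin (f x)).

Lemma linZ f c x : lin f -> f (c *: x) = c * f x.
Proof.
move=> f_lin; have f0 : f 0 = 0.
  by have := f_lin (-1) 0 0; rewrite scaler0 addr0 mulN1r addNr.
by rewrite -[c *: x]addr0 f_lin f0 addr0.
Qed.

Hypotheses (i_sqr : i ^+ 2 = -1) (J_sqr : forall x, J (J x) = - x).
Hypotheses (PE : forall x, P x = 2^-1 *: ((- i) *: J x + x))
           (QE : forall x, Q x = 2^-1 *: (i *: J x + x)).

(** Invariance and J^2 = -1 give f(x, Jy) = - f(Jx, y). In 4 f(Px, Py) the mixed terms then cancel
    each other and f(x, y) cancels f(Jx, Jy); likewise for [Q]. Since P + Q = 1, the mixed parts
    carry all of [f]. *)
Lemma bilin_type11 f : bilin f -> (forall x y, f (J x) (J y) = f x y) ->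
  forall x y,
  [/\ f (P x) (P y) = 0, f (Q x) (Q y) = 0 & f (P x) (Q y) + f (Q x) (P y) = f x y].
Proof.
move=> [fl fr] fJ x y.
have fJr : f x (J y) = - f (J x) y.
  by rewrite -fJ J_sqr -scaleN1r (linZ _ _ (fr _)) mulN1r.
have fZl c u v : f (c *: u) v = c * f u v := linZ c u (fl v).
have fZr c u v : f v (c *: u) = c * f v u := linZ c u (fr v).
have fDl c u v w : f (c *: u + v) w = c * f u w + f v w := fl w c u v.
have fDr c u v w : f w (c *: u + v) = c * f w u + f w v := fr w c u v.
rewrite !PE !QE !(fZl, fZr, fDl, fDr) fJ fJr.
by split; field: i_sqr.
Qed.

(** [T] is theta wedge sigma, and the left side is i times its (1,2)-part minus its (2,1)-part.
    Since sigma only pairs [P] with [Q], these parts are (theta o Q) wedge sigma and (theta o P)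
    wedge sigma, and i (Q - P) = - J. *)
Lemma dc_type11_identity theta sigma x y z : lin theta -> bilin sigma ->
    (forall x y, sigma (J x) (J y) = sigma x y) ->
  let T x y z := theta x * sigma y z - theta y * sigma x z + theta z * sigma x y in
  i * ((T (P x) (Q y) (Q z) + T (Q x) (P y) (Q z) + T (Q x) (Q y) (P z)) -
       (T (Q x) (P y) (P z) + T (P x) (Q y) (P z) + T (P x) (P y) (Q z))) =
  - (theta (J x) * sigma y z - theta (J y) * sigma x z + theta (J z) * sigma x y).
Proof.
move=> th_lin s_bil sJ T; rewrite /T.
(* The values of sigma on the right are split into their mixed parts, the only ones that remain on
   the left. *)
have [Pyz Qyz <-] := bilin_type11 s_bil sJ y z.
have [Pxz Qxz <-] := bilin_type11 s_bil sJ x z.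
have [Pxy Qxy <-] := bilin_type11 s_bil sJ x y.
rewrite !(Pyz, Qyz, Pxz, Qxz, Pxy, Qxy).
have thP u : theta (P u) = 2^-1 * (- i * theta (J u) + theta u).
  by rewrite PE (linZ _ _ th_lin) th_lin.
have thQ u : theta (Q u) = 2^-1 * (i * theta (J u) + theta u).
  by rewrite QE (linZ _ _ th_lin) th_lin.
rewrite !thP !thQ.
by field: i_sqr.
Qed.

End ComplexStructure.

(** * Bidegrees of 2- and 3-forms, and d^c of a form of type (1,1) *)

Section Bidegree.
Variables (R : realType) (m : nat) (J : 'M[R]_m).
Local Notation C := (R[i]).
Local Notation V := 'cV[C]_m.
Local Notation P := (proj10 J).
Local Notation Q := (proj01 J).
Implicit Types (f : V -> V -> C).

Lemma eq_bidegree (p k : nat) (alpha beta : kform C m k) :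
  alpha =1 beta -> bidegree J p alpha =1 bidegree J p beta.
Proof. by move=> eq_ab M; apply: eq_bigr => S _; rewrite eq_ab. Qed.

Lemma colv_pick (n : nat) (S : {set 'I_n.+1}) (M : 'M[C]_(m, n.+1)) (k : nat) :
  colv (\matrix_(i, j) (if j \in S then P *m M else Q *m M) i j) k =
  (if inord k \in S then P else Q) *m colv M k.
Proof.
by apply/colP => i; rewrite !mxE; case: ifP => _; rewrite !mxE;
   apply: eq_bigr => j _; rewrite !mxE.
Qed.

Lemma bidegree_form2 f (M : 'M[C]_(m, 2)) :
  let x := colv M 0 in let y := colv M 1 in
  [/\ bidegree J 0 (form2 f) M = f (Q *m x) (Q *m y),
      bidegree J 1 (form2 f) M = f (P *m x) (Q *m y) + f (Q *m x) (P *m y)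
    & bidegree J 2 (form2 f) M = f (P *m x) (P *m y)].
Proof.
move=> x y; split; rewrite /bidegree.
- by rewrite sum_set_card0 /form2 !colv_pick !inE.
- rewrite sum_set_card1 !big_ord_recl big_ord0 addr0 /form2 !colv_pick !inE.
  by rewrite -!val_eqE /= !inordK.
- have := sum_set_cardT (fun S : {set 'I_2} => form2 f
    (\matrix_(i, j) (if j \in S then P *m M else Q *m M) i j)).
  by rewrite card_ord => ->; rewrite /form2 !colv_pick !inE.
Qed.

Lemma bidegree_form3 (f : V -> V -> V -> C) (M : 'M[C]_(m, 3)) :
  let x := colv M 0 in let y := colv M 1 in let z := colv M 2 in
  bidegree J 1 (form3 f) M = f (P *m x) (Q *m y) (Q *m z) +
    f (Q *m x) (P *m y) (Q *m z) + f (Q *m x) (Q *m y) (P *m z) /\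
  bidegree J 2 (form3 f) M = f (Q *m x) (P *m y) (P *m z) +
    f (P *m x) (Q *m y) (P *m z) + f (P *m x) (P *m y) (Q *m z).
Proof.
move=> x y z; split; rewrite /bidegree.
- rewrite sum_set_card1 !big_ord_recl big_ord0 addr0 /form3 !colv_pick !inE.
  by rewrite -!val_eqE /= !inordK // addrA.
- rewrite sum_set_cardC1 !big_ord_recl big_ord0 addr0 /form3.
  by rewrite !colv_pick !inE -!val_eqE /= !inordK // addrA.
Qed.

Local Notation Jc := (cplx_mx J).
Hypothesis cplx_J_sqr : forall x : V, Jc *m (Jc *m x) = - x.

Lemma proj10E (x : V) : P *m x = 2^-1 *: ((- 'i%C) *: (Jc *m x) + x).
Proof. by rewrite -scalemxAl mulmxBl mul1mx -scalemxAl scaleNr addrC. Qed.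

Lemma proj01E (x : V) : Q *m x = 2^-1 *: ('i%C *: (Jc *m x) + x).
Proof. by rewrite -scalemxAl mulmxDl mul1mx -scalemxAl addrC. Qed.

Variable bracket : 'cV[R]_m -> 'cV[R]_m -> 'cV[R]_m.
Local Notation d := (ce_diff (cplx_bracket bracket)).

Lemma eq_dc (k : nat) (alpha beta : kform C m k) :
  alpha =1 beta -> dc bracket J alpha =1 dc bracket J beta.
Proof.
move=> eq_ab M; rewrite /dc /del /delbar; congr (_ * (_ - _));
  apply: eq_bigr => p _; apply: eq_bidegree; apply: eq_ce_diff;
  exact: eq_bidegree.
Qed.

(* If [omega] and [sigma] are of type (1,1) and [d omega = theta /\ sigma],
   then the parts of [d omega] of type (2,1) and (1,2) come from
   [theta^{1,0}] and [theta^{0,1}], and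
   [i (theta^{0,1} - theta^{1,0}) = - theta o J]. *)
Lemma dc_type11 (f : V -> V -> C) (theta : V -> C) sigma :
  bilin f -> (forall x y, f (Jc *m x) (Jc *m y) = f x y) ->
  lin theta ->
  bilin sigma -> (forall x y, sigma (Jc *m x) (Jc *m y) = sigma x y) ->
  d (form2 f) =1 form3 (fun x y z =>
    theta x * sigma y z - theta y * sigma x z + theta z * sigma x y) ->
  dc bracket J (form2 f) =1 form3 (fun x y z =>
    - (theta (Jc *m x) * sigma y z - theta (Jc *m y) * sigma x z +
       theta (Jc *m z) * sigma x y)).
Proof.
move=> f_bil fJ theta_lin s_bil sJ df M.
have f11 := bilin_type11 (sqr_i R) cplx_J_sqr proj10E proj01E f_bil fJ.
(* As [f] is of type (1,1), only the summand p = 1 of [del] and of [delbar] survives: it is the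
   (2,1)-part, respectively the (1,2)-part, of d f. *)
have bid0 : bidegree J 0 (form2 f) =1 form2 (fun _ _ => 0).
  move=> N; have [E0 _ _] := bidegree_form2 f N.
  by have [_ E _] := f11 (colv N 0) (colv N 1); exact: etrans E0 E.
have bid1 : bidegree J 1 (form2 f) =1 form2 f.
  move=> N; have [_ E1 _] := bidegree_form2 f N.
  by have [_ _ E] := f11 (colv N 0) (colv N 1); exact: etrans E1 E.
have bid2 : bidegree J 2 (form2 f) =1 form2 (fun _ _ => 0).
  move=> N; have [_ _ E2] := bidegree_form2 f N.
  by have [E _ _] := f11 (colv N 0) (colv N 1); exact: etrans E2 E.
have d0 : d (form2 (fun _ _ => 0)) =1 (fun _ => 0).
  by move=> N; rewrite ce_diff_form2 !(oppr0, addr0).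
have bid_d0 p (alpha : kform C m 2) : alpha =1 form2 (fun _ _ => 0) ->
    bidegree J p (d alpha) M = 0.
  move=> alpha0; rewrite /bidegree big1 // => S _.
  by rewrite (eq_ce_diff _ alpha0) d0.
have bid_d1 p : bidegree J p (d (bidegree J 1 (form2 f))) M =
    bidegree J p (form3 (fun x y z =>
    theta x * sigma y z - theta y * sigma x z + theta z * sigma x y)) M.
  by apply: eq_bidegree => N; rewrite (eq_ce_diff _ bid1) df.
have del_f : del bracket J (form2 f) M = bidegree J 2 (form3 (fun x y z =>
    theta x * sigma y z - theta y * sigma x z + theta z * sigma x y)) M.
  rewrite /del !big_ord_recl big_ord0 /= -bid_d1.
  by rewrite (bid_d0 _ _ bid0) (bid_d0 _ _ bid2) add0r !addr0.
have delbar_f : delbar bracket J (form2 f) M = bidegree J 1 (form3 (fun x y z =>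
    theta x * sigma y z - theta y * sigma x z + theta z * sigma x y)) M.
  rewrite /delbar !big_ord_recl big_ord0 /= -bid_d1.
  by rewrite (bid_d0 _ _ bid0) (bid_d0 _ _ bid2) add0r !addr0.
have [E1 E2] := bidegree_form3 (fun x y z =>
    theta x * sigma y z - theta y * sigma x z + theta z * sigma x y) M.
rewrite /dc del_f delbar_f E1 E2 {E1 E2 del_f delbar_f}.
exact: (dc_type11_identity (sqr_i R) cplx_J_sqr proj10E proj01E).
Qed.

End Bidegree.

(** * Bilinear forms given by Gram matrices *)

Section BilinearForms.
Variables (K : numFieldType) (m : nat).
Implicit Types (F G A : 'M[K]_m) (X Y Z : 'cV[K]_m).

Definition bform F X Y : K := (X^T *m F *m Y) 0 0.

Lemma bformDl F X Y Z : bform F (X + Y) Z = bform F X Z + bform F Y Z.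
Proof. by rewrite /bform linearD !mulmxDl mxE. Qed.
Lemma bformDr F X Y Z : bform F Z (X + Y) = bform F Z X + bform F Z Y.
Proof. by rewrite /bform mulmxDr mxE. Qed.
Lemma bformZl F c X Y : bform F (c *: X) Y = c * bform F X Y.
Proof. by rewrite /bform linearZ -!scalemxAl mxE. Qed.
Lemma bformZr F c X Y : bform F Y (c *: X) = c * bform F Y X.
Proof. by rewrite /bform -scalemxAr mxE. Qed.
Lemma bformNl F X Y : bform F (- X) Y = - bform F X Y.
Proof. by rewrite -scaleN1r bformZl mulN1r. Qed.
Lemma bformD F G X Y : bform (F + G) X Y = bform F X Y + bform G X Y.
Proof. by rewrite /bform mulmxDr mulmxDl mxE. Qed.
Lemma bformN F X Y : bform (- F) X Y = - bform F X Y.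
Proof. by rewrite /bform mulmxN mulNmx mxE. Qed.
Lemma bformZ c F X Y : bform (c *: F) X Y = c * bform F X Y.
Proof. by rewrite /bform -scalemxAr -scalemxAl mxE. Qed.
Lemma bform0 X Y : bform 0 X Y = 0.
Proof. by rewrite -(scale0r 0) bformZ mul0r. Qed.
Lemma bform0l F X : bform F 0 X = 0.
Proof. by rewrite -(scale0r 0) bformZl mul0r. Qed.
Lemma bform0r F X : bform F X 0 = 0.
Proof. by rewrite -(scale0r 0) bformZr mul0r. Qed.
Lemma bform_mull F A X Y : bform F (A *m X) Y = bform (A^T *m F) X Y.
Proof. by rewrite /bform trmx_mul !mulmxA. Qed.
Lemma bform_mulr F A X Y : bform F X (A *m Y) = bform (F *m A) X Y.
Proof. by rewrite /bform !mulmxA. Qed.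
Lemma bform_tr F X Y : bform F^T X Y = bform F Y X.
Proof.
by rewrite /bform -[in RHS]trace_mx11 -mxtrace_tr trace_mx11 !trmx_mul trmxK mulmxA.
Qed.
Lemma bform_delta F i j : bform F (delta_mx i 0) (delta_mx j 0) = F i j.
Proof. by rewrite /bform trmx_delta -rowE -colE !mxE. Qed.

Lemma bform_inj F G : (forall X Y, bform F X Y = bform G X Y) -> F = G.
Proof. by move=> FG; apply/matrixP => i j; rewrite -!bform_delta. Qed.

Definition bwedge F G X Y Z W : K :=
  bform F X Y * bform G Z W - bform F X Z * bform G Y W
  + bform F X W * bform G Y Z + bform F Y Z * bform G X W
  - bform F Y W * bform G X Z + bform F Z W * bform G X Y.

Lemma wedge_bform F G : F^T = - F -> G^T = - G -> forall M,
  wedge (form2 (bform F)) (form2 (bform G)) M =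
  bwedge F G (colv M 0) (colv M 1) (colv M 2) (colv M 3).
Proof.
by move=> FN GN M; apply: wedge_form22 => X Y; rewrite -bform_tr ?FN ?GN bformN.
Qed.

End BilinearForms.

(** * The Lie algebra over a general field: d omega and d of d^c omega *)

Section GeneralMu.
Variables (K : numFieldType) (m : nat).
Local Notation V := 'cV[K]_(1 + (m + 1)).
Implicit Types (x y z w : V) (X Y Z W : 'cV[K]_m).

Definition gvec (s : K) X (t : K) : V := col_mx s%:M (col_mx X t%:M).
Definition coord1 x : K := usubmx x 0 0.
Definition coordk x : 'cV[K]_m := usubmx (dsubmx x).
Definition coord2n x : K := dsubmx (dsubmx x) 0 0.

Lemma gvecK s X t :
  (coord1 (gvec s X t) = s) * (coordk (gvec s X t) = X) *
  (coord2n (gvec s X t) = t).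
Proof.
by rewrite /coord1 /coordk /coord2n /gvec !col_mxKd !col_mxKu !mxE eqxx.
Qed.

Lemma gvec_coord x : gvec (coord1 x) (coordk x) (coord2n x) = x.
Proof. by rewrite /gvec -!mx11_scalar !vsubmxK. Qed.

Lemma coordP x y : coord1 x = coord1 y -> coordk x = coordk y ->
  coord2n x = coord2n y -> x = y.
Proof. by move=> e1 e2 e3; rewrite -(gvec_coord x) e1 e2 e3 gvec_coord. Qed.

Lemma coord1_lin : lin coord1.
Proof. by move=> c x y; rewrite /coord1 linearP !mxE. Qed.
Lemma coord2n_lin : lin coord2n.
Proof. by move=> c x y; rewrite /coord2n !linearP !mxE. Qed.
Lemma coordk_lin c x y : coordk (c *: x + y) = c *: coordk x + coordk y.
Proof. by rewrite /coordk !linearP. Qed.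

(** A version of [mu] with eta replaced by its Gram matrix [E]; it is used over R for the Kahler
    condition and over R[i] for the SKT condition. *)
Definition gmu (a : K) (A E : 'M[K]_m) x y : V :=
  gvec (a * (coord2n x * coord1 y - coord2n y * coord1 x)
          - bform E (coordk x) (coordk y))
       (coord2n x *: (A *m coordk y) - coord2n y *: (A *m coordk x))
       0.

Lemma gmu_linl a A E c x y z :
  gmu a A E (c *: x + y) z = c *: gmu a A E x z + gmu a A E y z.
Proof.
apply: coordP; rewrite ?(coord1_lin, coordk_lin, coord2n_lin) !gvecK
  ?(coord1_lin, coordk_lin, coord2n_lin) ?(bformDl, bformZl) ?mulr0 ?addr0 //.
- by ring.
- rewrite mulmxDr -scalemxAr !(scalerDl, scalerDr, scalerN, scalerA, opprD).
  by rewrite (mulrC (coord2n z)) addrACA.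
Qed.

Lemma gmu_linr a A E c x y z :
  gmu a A E z (c *: x + y) = c *: gmu a A E z x + gmu a A E z y.
Proof.
apply: coordP; rewrite ?(coord1_lin, coordk_lin, coord2n_lin) !gvecK
  ?(coord1_lin, coordk_lin, coord2n_lin) ?(bformDr, bformZr) ?mulr0 ?addr0 //.
- by ring.
- rewrite mulmxDr -scalemxAr !(scalerDl, scalerDr, scalerN, scalerA, opprD).
  by rewrite (mulrC (coord2n z)) addrACA.
Qed.

Definition gJ (J : 'M[K]_m) : 'M[K]_(1 + (m + 1)) :=
  block_mx 0 (row_mx 0 (-1)%:M)
           (col_mx 0 1%:M) (block_mx J 0 0 0).

Lemma gJ_vec J s X t : gJ J *m gvec s X t = gvec (- t) (J *m X) s.
Proof.
rewrite /gJ /gvec mul_block_col mul_row_col mul_col_mx mul_block_col.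
by rewrite !mul0mx !add0r add_col_mx !addr0 !mul1mx !add0r -scalar_mxM mulN1r.
Qed.

Lemma coord_gJ J x : (coord1 (gJ J *m x) = - coord2n x) *
  (coordk (gJ J *m x) = J *m coordk x) * (coord2n (gJ J *m x) = coord1 x).
Proof. by rewrite -[x in gJ J *m x]gvec_coord gJ_vec !gvecK. Qed.

(** The transpose appears because g(JX, Y) = X^T J^T Y; the first two terms are e^1 wedge e^{2n}. *)
Definition gomega (J : 'M[K]_m) x y : K :=
  coord1 x * coord2n y - coord2n x * coord1 y
  + bform J^T (coordk x) (coordk y).

Lemma fund_form_gJ J : fund_form (gJ J) =1 form2 (gomega J).
Proof.
move=> M; rewrite /fund_form /form2 !col_colv /=.
set x := colv M 0; set y := colv M 1.
rewrite /std_form /gomega -[in LHS](gvec_coord x) -[in LHS](gvec_coord y) gJ_vec.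
rewrite /gvec !tr_col_mx !mul_row_col !tr_scalar_mx !mul_scalar_mx.
have scE (c d : K) : (c *: d%:M : 'M_1) 0 0 = c * d by rewrite !mxE eqxx.
rewrite [LHS]mxE [X in _ + X]mxE !scE trmx_mul -/(bform _ _ _).
ring.
Qed.

Variables (a : K) (A E J : 'M[K]_m).
Hypotheses (E_skew : E^T = - E) (J_skew : J^T = - J).

(* The Gram matrix of [eta - A^*omega] on [k_1]. *)
Definition sigma_mx := E - (A^T *m J^T + J^T *m A).

Lemma sigma_skew : sigma_mx^T = - sigma_mx.
Proof.
rewrite /sigma_mx linearB linearD /= !trmx_mul E_skew !trmxK J_skew.
by rewrite !(mulNmx, mulmxN) -!opprD opprK [J *m A + _]addrC.
Qed.

(** The part e^1 wedge e^{2n} of omega contributes e^{2n} wedge eta, and the part on k_1 contributes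
    - e^{2n} wedge A^*omega. *)
Lemma ce_diff_gomega : ce_diff (gmu a A E) (form2 (gomega J)) =1
  form3 (fun x y z =>
    coord2n x * bform sigma_mx (coordk y) (coordk z)
    - coord2n y * bform sigma_mx (coordk x) (coordk z)
    + coord2n z * bform sigma_mx (coordk x) (coordk y)).
Proof.
move=> M; rewrite ce_diff_form2 /form3.
move: (colv M 0) (colv M 1) (colv M 2) => x y z.
(* The two halves of A^*omega are transposes of each other up to sign; trading one for the other
   leaves a single family of atoms for [ring]. *)
have JA X Y : bform (J^T *m A) X Y = - bform (A^T *m J^T) Y X.
  by rewrite -bform_tr trmx_mul trmxK J_skew mulmxN bformN opprK.
rewrite /gomega !gvecK /sigma_mx.
rewrite !(bformDl, bformZl, bformNl, bform_mull, bformD, bformN, JA).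
ring.
Qed.

Lemma gomega_bilin : bilin (gomega J).
Proof.
by split=> y c x z; rewrite /gomega coord1_lin coord2n_lin coordk_lin
  ?(bformDl, bformZl, bformDr, bformZr); ring.
Qed.

Lemma bform_coordk_bilin F : bilin (fun x y => bform F (coordk x) (coordk y)).
Proof.
by split=> y c x z; rewrite coordk_lin ?(bformDl, bformZl, bformDr, bformZr).
Qed.

Hypotheses (J_sqr : J *m J = - 1%:M) (AJ : A *m J = J *m A).
Hypothesis E_J : J^T *m E *m J = E.

Lemma J_orth : J^T *m J = 1%:M.
Proof. by rewrite J_skew mulNmx J_sqr opprK. Qed.

Lemma AtJt : A^T *m J^T = J^T *m A^T.
Proof. by rewrite -!trmx_mul AJ. Qed.

Lemma gJ_sqr x : gJ J *m (gJ J *m x) = - x.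
Proof.
rewrite -[x in LHS]gvec_coord !gJ_vec mulmxA J_sqr mulNmx mul1mx.
by rewrite -[x in RHS]gvec_coord /gvec !opp_col_mx -!raddfN.
Qed.

Lemma gomega_gJ x y : gomega J (gJ J *m x) (gJ J *m y) = gomega J x y.
Proof.
rewrite /gomega !coord_gJ bform_mull bform_mulr -!mulmxA J_orth mulmx1.
ring.
Qed.

(** Both terms of sigma are of type (1,1): eta by assumption, A^*omega because [A] commutes with the
    orthogonal map [J]. *)
Lemma sigma_gJ x y :
  bform sigma_mx (coordk (gJ J *m x)) (coordk (gJ J *m y)) =
  bform sigma_mx (coordk x) (coordk y).
Proof.
rewrite !coord_gJ bform_mull bform_mulr; congr (bform _ _ _).
rewrite /sigma_mx mulmxBr mulmxBl E_J mulmxDr mulmxDl; congr (_ - (_ + _)).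
  by rewrite -!mulmxA J_orth mulmx1 AtJt.
by rewrite -!mulmxA AJ [J^T *m (J *m A)]mulmxA J_orth mul1mx.
Qed.

(* The Gram matrix of [a sigma + A^*sigma], the factor of [e^1 /\ e^{2n}] in
   [- d d^c omega]. *)
Definition ddc_mx := a *: sigma_mx + A^T *m sigma_mx + sigma_mx *m A.

(** Here [pq] is e^1 wedge e^{2n}, and the six terms with [U] are the shuffle expansion of its wedge
    with a sigma + A^*sigma. The coefficient a comes from d e^1, the A^*sigma from d sigma. *)
Lemma ce_diff_dc_gomega M :
  let x := colv M 0 in let y := colv M 1 in
  let z := colv M 2 in let w := colv M 3 in
  let pq u v := coord1 u * coord2n v - coord1 v * coord2n u in
  let U u v := bform ddc_mx (coordk u) (coordk v) in
  ce_diff (gmu a A E) (form3 (fun x y z =>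
    - (coord1 x * bform sigma_mx (coordk y) (coordk z)
       - coord1 y * bform sigma_mx (coordk x) (coordk z)
       + coord1 z * bform sigma_mx (coordk x) (coordk y)))) M =
  - (bwedge E sigma_mx (coordk x) (coordk y) (coordk z) (coordk w)
     + pq x y * U z w - pq x z * U y w + pq x w * U y z
     + pq y z * U x w - pq y w * U x z + pq z w * U x y).
Proof.
move=> x y z w pq U; rewrite ce_diff_form3 -/x -/y -/z -/w.
move: x y z w => x y z w; rewrite {}/pq {}/U.
have SA X Y : bform (sigma_mx *m A) X Y = - bform (A^T *m sigma_mx) Y X.
  by rewrite -bform_tr trmx_mul sigma_skew mulmxN bformN.
rewrite /bwedge /ddc_mx !gvecK.
rewrite !(bformDl, bformZl, bformNl, bform_mull, bformD, bformN, bformZ, SA).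
ring.
Qed.

(** The two summands are separated by test vectors: four vectors of k_1 kill e^1 wedge e^{2n}, while
    on e_1, e_{2n}, X, Y the term eta wedge sigma vanishes and exactly [ddc_mx] at (X, Y) remains,
    up to sign. *)
Lemma ddc_gomega_eq0 : (ce_diff (gmu a A E)
  (form3 (fun x y z =>
    - (coord1 x * bform sigma_mx (coordk y) (coordk z)
       - coord1 y * bform sigma_mx (coordk x) (coordk z)
       + coord1 z * bform sigma_mx (coordk x) (coordk y)))) =1 fun _ => 0) <->
  (forall X Y Z W, bwedge E sigma_mx X Y Z W = 0) /\ ddc_mx = 0.
Proof.
split=> [ddc0 | [wedge0 U0] M].
- have ddc x y z w :=
    ddc0 (row_mx x (row_mx y (row_mx z (row_mx w (0 : 'M_(_, 0))))) : 'M_(_, 4)).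
  split=> [X Y Z W | ].
    have := ddc (gvec 0 X 0) (gvec 0 Y 0) (gvec 0 Z 0) (gvec 0 W 0).
    rewrite ce_diff_dc_gomega /= !colv_row_mxS // !colv_row_mx0 !gvecK => ddcE.
    by apply: oppr_inj; rewrite oppr0 -[RHS]ddcE; ring.
  apply: bform_inj => X Y; rewrite bform0.
  have := ddc (gvec 1 0 0) (gvec 0 0 1) (gvec 0 X 0) (gvec 0 Y 0).
  rewrite ce_diff_dc_gomega /= !colv_row_mxS // !colv_row_mx0 !gvecK => ddcE.
  by apply: oppr_inj; rewrite oppr0 -[RHS]ddcE /bwedge !(bform0l, bform0r); ring.
- rewrite ce_diff_dc_gomega /= wedge0 U0.
  by rewrite !bform0 !mulr0 !(addr0, subr0) oppr0.
Qed.

Hypothesis A_E : A^T *m E + E *m A = a *: E.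

(** Applying A^* twice to omega gives (A^2)^*omega plus twice the form with matrix A^T J^T A. As [A]
    and [A^T] commute with [J^T], both halves of (A^T A)^*omega equal that matrix. The eta terms add
    up to 2 a eta by A^*eta = a eta. *)
Lemma ddc_mx_eq0 : ddc_mx = 0 <->
  (a *: A + A *m A + A^T *m A)^T *m J^T + J^T *m (a *: A + A *m A + A^T *m A)
  = (2 * a) *: E.
Proof.
have AJt : A *m J^T = J^T *m A by rewrite J_skew mulmxN mulNmx AJ.
have -> : ddc_mx = (2 * a) *: E -
    ((a *: A + A *m A + A^T *m A)^T *m J^T + J^T *m (a *: A + A *m A + A^T *m A)).
  rewrite /ddc_mx /sigma_mx !linearD /= linearZ /= !trmx_mul trmxK.
  rewrite !(mulmxDl, mulmxDr, mulmxBl, mulmxBr) -!mulmxA AJt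
    -!scalemxAl -!scalemxAr.
  rewrite !(mulNmx, mulmxN) !mulmxA -AtJt.
  have -> : E *m A = a *: E - A^T *m E by rewrite -A_E [RHS]addrC addKr.
  (* With the products generalised to arbitrary matrices, the identity is linear and holds entry by
     entry. *)
  move: (A^T *m J^T *m A) (A^T *m A^T *m J^T) (J^T *m A *m A) (A^T *m J^T)
    (J^T *m A) (A^T *m E) => M1 M2 M3 M4 M5 M6.
  by apply/matrixP => i j; rewrite !mxE; ring.
by split=> [/eqP|->]; rewrite ?subrr // subr_eq0 => /eqP ->.
Qed.

End GeneralMu.

(** * The standard complex structure on k_1 *)

Section StdComplexStructure.
Variables (R : realType) (n : nat).
Local Notation J := (J_k1 R n).

Lemma J_k1_skew : J^T = - J.
Proof.
apply/matrixP => i j; rewrite !mxE.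
have [-> /=|ij] := eqVneq (i : nat) j.+1.
  by rewrite eqn_leq ltnNge leqnSn andbF /=;
    case: (odd j); rewrite /= ?opprK ?oppr0.
have [-> /=|ji] := eqVneq (j : nat) i.+1.
  by case: (odd i); rewrite /= ?opprK ?oppr0.
by rewrite !andbF oppr0.
Qed.

(** Column [k] of [J] has one nonzero entry: 1 in row k+1 if [k] is even, -1 in row k-1 if [k] is
    odd. For even [k] the row k+1 exists because the dimension is even. So the sum defining each
    entry of the square has at most one nonzero term. *)
Lemma J_k1_sqr : J *m J = - 1%:M.
Proof.
apply/matrixP => i k; rewrite !mxE.
have lt_k := ltn_ord k; have odd_dim : odd (dim_k1 n) = false by rewrite odd_double.
case k_odd : (odd k).
- have lt_k' : (k.-1 < dim_k1 n)%N by lia.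
  have kE : k.-1.+1 = k by lia.
  have k'_even : odd k.-1 = false by lia.
  rewrite (bigD1 (Ordinal lt_k')) //= big1 ?addr0 => [|j]; rewrite !mxE k_odd /=.
    by rewrite kE eqxx k'_even /= val_eqE;
      case: (i == k); rewrite ?mul0r ?oppr0 ?mul1r.
  by rewrite -val_eqE eq_sym /= -eqSS kE => /negbTE ->; rewrite mulr0.
- have lt_k' : (k.+1 < dim_k1 n)%N by lia.
  rewrite (bigD1 (Ordinal lt_k')) //= big1 ?addr0 => [|j]; rewrite !mxE k_odd /=.
    rewrite k_odd eqxx eqSS mulr1 /= val_eqE eq_sym.
    by case: (i == k); rewrite ?oppr0.
  by rewrite -val_eqE /= => /negbTE ->; rewrite mulr0.
Qed.

End StdComplexStructure.

(** * Gram matrices of exterior 2-forms, and the action of endomorphisms on them *)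

Section LinearForms.
Variables (K : numFieldType) (m : nat).

Lemma bilin_bform (f : 'cV[K]_m -> 'cV[K]_m -> K) : bilin f ->
  forall X Y, f X Y = bform (\matrix_(i, j) f (delta_mx i 0) (delta_mx j 0)) X Y.
Proof.
move=> [fl fr] X Y.
have lin_sum (g : 'cV[K]_m -> K) Z : lin g ->
    g Z = \sum_i Z i 0 * g (delta_mx i 0).
  move=> g_lin; rewrite {1}(matrix_sum_delta Z).
  under eq_bigr do rewrite big_ord1.
  elim/big_rec2: _ => [|i u v _ <-]; last by rewrite g_lin.
  by rewrite -(scale0r 0) linZ // mul0r.
rewrite (lin_sum _ _ (fl Y)) /bform -mulmxA mxE; apply: eq_bigr => i _.
rewrite !mxE (lin_sum _ _ (fr _)); congr (_ * _); apply: eq_bigr => j _.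
by rewrite mxE mulrC.
Qed.

Lemma colv1 (X : 'cV[K]_m) : colv X 0 = X.
Proof. by rewrite /colv; apply/colP => i; rewrite !mxE ord1. Qed.

Lemma row_mx_colv (M : 'M[K]_(m, 2)) :
  M = row_mx (colv M 0) (colv M 1) :> 'M_(m, 1 + 1).
Proof.
apply/matrixP => i j; rewrite -[j in RHS]splitK /unsplit.
case: (splitP j) => j' jE; rewrite ?row_mxEl ?row_mxEr mxE; congr (M _ _);
  by apply: val_inj; rewrite /= jE ord1 inordK.
Qed.

(** With two columns, deleting one leaves the other, so the linearity clause of [exterior_form] is
    bilinearity in the usual sense; the alternating clause is polarised to skew-symmetry. *)
Lemma exterior_form2E (eta : kform K m 2) : exterior_form eta ->
  exists E : 'M[K]_m, E^T = - E /\ eta =1 form2 (bform E).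
Proof.
move=> [mlin alt]; pose r (X Y : 'cV[K]_m) : 'M[K]_(m, 2) := row_mx X Y.
pose f X Y := eta (r X Y).
have col0 X Y : col 0 (r X Y) = X by rewrite col_colv colv_row_mx0.
have col1 X Y : col 1 (r X Y) = Y by rewrite col_colv colv_row_mxS ?colv1.
have col0' X Y : col' 0 (r X Y) = Y.
  by rewrite -[LHS]colv1 colv_col' // colv_row_mxS ?colv1.
have col1' X Y : col' 1 (r X Y) = X.
  by rewrite -[LHS]colv1 colv_col' // colv_row_mx0.
have f_bil : bilin f.
  split=> [Y c X X' | X c Y Y'].
    by apply: (mlin 0 c (r (c *: X + X') Y) (r X Y) (r X' Y)); rewrite ?col0 ?col0'.
  by apply: (mlin 1 c (r X (c *: Y + Y')) (r X Y) (r X Y')); rewrite ?col1 ?col1'.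
have f_alt X : f X X = 0 by apply: (alt 0 1) => //; rewrite col0 col1.
have f_skew X Y : f Y X = - f X Y.
  (* The coefficient 1 gives the sum the shape c x + y in which [lin] is stated. *)
  have := f_alt (1 *: X + Y); rewrite (f_bil.1 _ 1) !(f_bil.2 _ 1) !f_alt.
  by rewrite !mul1r add0r addr0 => /eqP; rewrite addrC addr_eq0 => /eqP.
exists (\matrix_(i, j) f (delta_mx i 0) (delta_mx j 0)); split.
  by apply/matrixP => i j; rewrite !mxE.
by move=> M; rewrite {1}[M]row_mx_colv -/(f _ _) bilin_bform.
Qed.

Lemma eq_act2 (A : 'M[K]_m) (f g : kform K m 2) :
  f =1 g -> act2 A f =1 act2 A g.
Proof. by move=> fg M; rewrite /act2 !fg. Qed.

Lemma act2_bform (A F : 'M[K]_m) :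
  act2 A (form2 (bform F)) =1 form2 (bform (A^T *m F + F *m A)).
Proof.
move=> M; rewrite /act2 !form2_row_mx.
by rewrite !colv1 !col_colv bform_mull bform_mulr -bformD.
Qed.

Lemma eq_wedge (p q : nat) (f f' : kform K m p) (g g' : kform K m q) :
  f =1 f' -> g =1 g' -> wedge f g =1 wedge f' g'.
Proof.
move=> ff gg M; rewrite /wedge; congr (_ * _).
by apply: eq_bigr => s _; rewrite ff gg.
Qed.

Lemma form2_bform_inj (F G : 'M[K]_m) :
  form2 (bform F) =1 form2 (bform G) <-> F = G.
Proof.
split=> [FG | -> //]; apply: bform_inj => X Y.
have := FG (row_mx X Y : 'M_(m, 1 + 1)); by rewrite !form2_row_mx colv1.
Qed.

End LinearForms.

(** * Linearity of the wedge product of Gram matrices *)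

Section Bwedge.
Variables (K : numFieldType) (m : nat) (E F : 'M[K]_m).
Implicit Types X Y Z W : 'cV[K]_m.

Lemma bwedge_lin X Y Z W :
  [/\ lin (fun T => bwedge E F T Y Z W), lin (fun T => bwedge E F X T Z W),
      lin (fun T => bwedge E F X Y T W) & lin (fun T => bwedge E F X Y Z T)].
Proof.
by split=> c S T; rewrite /bwedge !(bformDl, bformDr, bformZl, bformZr); ring.
Qed.

Lemma bwedgeBr G X Y Z W :
  bwedge E (F - G) X Y Z W = bwedge E F X Y Z W - bwedge E G X Y Z W.
Proof. by rewrite /bwedge !(bformD, bformN); ring. Qed.

End Bwedge.

(** * Passage between the real Lie algebra and its complexification *)

Section Complexification.
Variables (R : realType).
Local Notation C := (R[i]).
Local Notation cx := (@cplx_mx R _ _).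

(** The imaginary part comes first so that the right side has the shape c x + y of [lin], [gmu_linl]
    and [gmu_linr]. *)
Lemma cplx_mx_ReIm (p q : nat) (z : 'M[C]_(p, q)) :
  z = 'i%C *: cx (map_mx (@complex.Im R) z) + cx (map_mx (@complex.Re R) z).
Proof. by apply/matrixP => i j; rewrite !mxE addrC -complexE. Qed.

Variable m : nat.
Implicit Types (A E F : 'M[R]_m) (X Y Z W : 'cV[R]_m) (x y : 'cV[R]_(1 + (m + 1))).

Lemma bform_cplx F X Y : bform (cx F) (cx X) (cx Y) = (bform F X Y)%:C%C.
Proof. by rewrite /bform /cplx_mx map_trmx -!map_mxM mxE. Qed.

Lemma coord_cplx x : (coord1 (cx x) = (coord1 x)%:C%C) *
  (coordk (cx x) = cx (coordk x)) * (coord2n (cx x) = (coord2n x)%:C%C).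
Proof.
rewrite /coord1 /coord2n /coordk /cplx_mx; split; first split.
- by rewrite -map_usubmx mxE.
- by rewrite -map_dsubmx -map_usubmx.
- by rewrite -!map_dsubmx mxE.
Qed.

Lemma gmu_cplx a A E x y :
  gmu a%:C%C (cx A) (cx E) (cx x) (cx y) = cx (gmu a A E x y).
Proof.
apply: coordP; rewrite coord_cplx !gvecK ?coord_cplx.
- by rewrite bform_cplx !(rmorphB, rmorphM).
- by rewrite /cplx_mx map_mxB !map_mxZ !map_mxM.
- by rewrite rmorph0.
Qed.

(** Both sides extend the real bracket complex-bilinearly. Splitting the arguments of [gmu] into
    real and imaginary parts yields four real brackets, recombined with i^2 = -1. *)
Lemma cplx_bracket_gmu br a A E :
  (forall x y, br x y = gmu a A E x y) ->
  forall z w, cplx_bracket br z w = gmu a%:C%C (cx A) (cx E) z w.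
Proof.
move=> brE z w; rewrite /cplx_bracket !brE.
rewrite [in RHS](cplx_mx_ReIm z) [in RHS](cplx_mx_ReIm w).
rewrite !(gmu_linl, gmu_linr) !gmu_cplx.
move: (gmu _ _ _ _ _) (gmu _ _ _ _ _) (gmu _ _ _ _ _) (gmu _ _ _ _ _).
move=> u1 u2 u3 u4; apply/matrixP => i j; rewrite !mxE !(rmorphB, rmorphD).
by ring: (sqr_i R).
Qed.

Lemma gJ_cplx F : cx (gJ F) = gJ (cx F).
Proof.
rewrite /cplx_mx /gJ !(map_block_mx, map_row_mx, map_col_mx, map_mx0).
rewrite !map_scalar_mx.
by rewrite rmorphN1 rmorph1.
Qed.

Lemma lin_real_eq0 (f : 'cV[C]_m -> C) :
  lin f -> (forall X, f (cx X) = 0) -> forall z, f z = 0.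
Proof. by move=> f_lin f0 z; rewrite [z]cplx_mx_ReIm f_lin !f0 mulr0 addr0. Qed.

Lemma bwedge_cplx E F X Y Z W :
  bwedge (cx E) (cx F) (cx X) (cx Y) (cx Z) (cx W) = (bwedge E F X Y Z W)%:C%C.
Proof. by rewrite /bwedge !bform_cplx !(rmorphD, rmorphN, rmorphM). Qed.

Lemma bwedge_cplx_eq0 E F :
  (forall X Y Z W : 'cV[C]_m, bwedge (cx E) (cx F) X Y Z W = 0) <->
  (forall X Y Z W, bwedge E F X Y Z W = 0).
Proof.
split=> EF0 X Y Z W; first by apply: complexI; rewrite -bwedge_cplx EF0.
have L := @bwedge_lin _ _ (cx E) (cx F).
(* Real vectors span the complexification, so the arguments are made real one at a time; each [0]
   fills the slot that varies. *)
have [L1 _ _ _] := L 0 Y Z W; apply: (lin_real_eq0 L1) => X'.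
have [_ L2 _ _] := L (cx X') 0 Z W; apply: (lin_real_eq0 L2) => Y'.
have [_ _ L3 _] := L (cx X') (cx Y') 0 W; apply: (lin_real_eq0 L3) => Z'.
have [_ _ _ L4] := L (cx X') (cx Y') (cx Z') 0; apply: (lin_real_eq0 L4) => W'.
by rewrite bwedge_cplx EF0.
Qed.

Lemma sigma_mx_cplx A E F : sigma_mx (cx A) (cx E) (cx F) = cx (sigma_mx A E F).
Proof. by rewrite /sigma_mx /cplx_mx map_mxB map_mxD !map_mxM !map_trmx. Qed.

Lemma ddc_mx_cplx a A E F :
  ddc_mx a%:C%C (cx A) (cx E) (cx F) = cx (ddc_mx a A E F).
Proof.
rewrite /ddc_mx sigma_mx_cplx; move: (sigma_mx A E F) => S.
rewrite /cplx_mx !map_mxD map_mxZ !map_mxM.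
by rewrite map_trmx.
Qed.

Lemma cplx_mx_eq0 F : cx F = 0 <-> F = 0.
Proof.
split=> [/matrixP F0 | ->]; last exact: map_mx0.
by apply/matrixP => i j; have := F0 i j; rewrite !mxE => /complexI.
Qed.

Local Notation g := 'cV[R]_(1 + (m + 1)).
Variables (br : g -> g -> g).
Variables (a : R) (A E J : 'M[R]_m).
Hypothesis brE : forall x y, br x y = gmu a A E x y.
Hypotheses (E_skew : E^T = - E) (J_skew : J^T = - J) (J_sqr : J *m J = - 1%:M).
Hypotheses (AJ : A *m J = J *m A) (E_J : J^T *m E *m J = E).

(** [SKT] speaks of complex forms, so [ddc_gomega_eq0] is applied to the complexified matrices and
    its two conditions are then brought back to R. *)
Lemma SKT_gmu : SKT br (gJ J) <->
  (forall X Y Z W, bwedge E (sigma_mx A E J) X Y Z W = 0) /\ ddc_mx a A E J = 0.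
Proof.
have cE_skew : (cx E)^T = - cx E by rewrite /cplx_mx map_trmx E_skew map_mxN.
have cJ_skew : (cx J)^T = - cx J by rewrite /cplx_mx map_trmx J_skew map_mxN.
have cJ_sqr : cx J *m cx J = - 1%:M.
  by rewrite /cplx_mx -map_mxM J_sqr map_mxN map_mx1.
have cAJ : cx A *m cx J = cx J *m cx A by rewrite /cplx_mx -!map_mxM AJ.
have cE_J : (cx J)^T *m cx E *m cx J = cx E.
  by rewrite /cplx_mx map_trmx -!map_mxM E_J.
have gJ2 (x : 'cV[C]_(1 + (m + 1))) : cx (gJ J) *m (cx (gJ J) *m x) = - x.
  by rewrite gJ_cplx gJ_sqr.
(* This is d^c omega = - e^1 wedge sigma: [dc_type11] applies with theta = [coord2n], and composing
   [coord2n] with the complex structure gives [coord1]. *)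
have dcE : dc br (gJ J) (fund_form (cx (gJ J))) =1
    form3 (fun x y z : 'cV[C]_(1 + (m + 1)) =>
    - (coord1 x * bform (sigma_mx (cx A) (cx E) (cx J)) (coordk y) (coordk z)
       - coord1 y * bform (sigma_mx (cx A) (cx E) (cx J)) (coordk x) (coordk z)
       + coord1 z * bform (sigma_mx (cx A) (cx E) (cx J)) (coordk x) (coordk y))).
  have fund : form2 (gomega (cx J)) =1 fund_form (cx (gJ J)).
    by move=> M; rewrite gJ_cplx fund_form_gJ.
  move=> M; rewrite -(eq_dc _ _ fund).
  rewrite (dc_type11 gJ2 (gomega_bilin (cx J)) _ (@coord2n_lin _ m)
    (bform_coordk_bilin (sigma_mx (cx A) (cx E) (cx J)))) => [|x y|x y|N].
  - by rewrite /form3 gJ_cplx !coord_gJ.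
  - by rewrite gJ_cplx gomega_gJ.
  - by rewrite gJ_cplx sigma_gJ.
  - rewrite -(ce_diff_gomega a%:C%C (cx A) (cx E) cJ_skew).
    by apply: eq_ce_diff_bracket; exact: cplx_bracket_gmu brE.
rewrite -bwedge_cplx_eq0 -sigma_mx_cplx -cplx_mx_eq0 -ddc_mx_cplx.
rewrite -(ddc_gomega_eq0 a%:C%C (cx A) cE_skew cJ_skew).
have d_dc := eq_ce_diff (cplx_bracket br) dcE.
have d_br := eq_ce_diff_bracket _ (cplx_bracket_gmu brE).
split=> [skt M | ddc0 M].
  by rewrite -d_br -d_dc skt.
by rewrite d_dc d_br ddc0.
Qed.

(** Evaluating d omega = e^{2n} wedge sigma on e_{2n}, X, Y recovers sigma(X, Y). *)
Lemma Kahler_gmu : Kahler br (gJ J) <-> sigma_mx A E J = 0.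
Proof.
rewrite /Kahler; split=> [kahler | sigma0 M].
  apply: bform_inj => X Y; rewrite bform0.
  have := kahler (row_mx (gvec 0 0 1) (row_mx (gvec 0 X 0) (row_mx (gvec 0 Y 0)
    (0 : 'M_(_, 0)))) : 'M_(_, 3)).
  rewrite (eq_ce_diff _ (fund_form_gJ J)) (eq_ce_diff_bracket _ brE).
  rewrite ce_diff_gomega // /form3.
  rewrite !colv_row_mxS // !colv_row_mx0 !gvecK => <-.
  by ring.
rewrite (eq_ce_diff _ (fund_form_gJ J)) (eq_ce_diff_bracket _ brE).
rewrite ce_diff_gomega // sigma0 /form3.
by rewrite !bform0 !mulr0 !(addr0, subr0).
Qed.

End Complexification.

(** * Return to [mu] and [omega_k1], and the theorem *)

Lemma omega_k1E (R : realType) (n : nat) :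
  omega_k1 R n =1 form2 (bform (J_k1 R n)^T).
Proof.
move=> M; rewrite /omega_k1 /restr_k1.
(* [J_std] is convertible to [gJ] at [J_k1], so the general formula for omega applies. *)
rewrite [LHS](fund_form_gJ (J_k1 R n) (col_mx 0 (col_mx M 0))) /form2 /gomega.
have colvE k : colv (col_mx 0 (col_mx M 0)) k = gvec 0 (colv M k) 0.
  by rewrite /colv /gvec !col_col_mx !raddf0.
by rewrite !colvE !gvecK mulr0 subr0 add0r.
Qed.

Theorem theorem4p2 (R : realType) (n : nat) (a : R)
    (A : 'M[R]_(dim_k1 n)) (eta : kform R (dim_k1 n) 2) :
  (2 <= n)%N ->
  exterior_form eta ->
  (exists M, eta M != 0) ->
  (forall M, act2 A eta M = a * eta M) ->
  A *m J_k1 R n = J_k1 R n *m A ->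
  (forall M, eta (J_k1 R n *m M) = eta M) ->
  (SKT (mu a A eta) (J_std R n) <->
     (forall M, wedge eta eta M = wedge eta (act2 A (omega_k1 R n)) M) /\
     (forall M, act2 (a *: A + A *m A + A^T *m A) (omega_k1 R n) M
                = 2 * a * eta M)) /\
  (Kahler (mu a A eta) (J_std R n) <->
     forall M, eta M = act2 A (omega_k1 R n) M).
Proof.
move=> _ eta_ext _ A_eta AJ eta_J.
have [E [E_skew etaE]] := exterior_form2E eta_ext.
pose J := J_k1 R n.
have J_skew : J^T = - J := J_k1_skew R n.
have J_sqr : J *m J = - 1%:M := J_k1_sqr R n.
have A_E : A^T *m E + E *m A = a *: E.
  apply/form2_bform_inj => M; rewrite -act2_bform -(eq_act2 _ etaE) A_eta etaE.
  by rewrite /form2 bformZ.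
have E_J : J^T *m E *m J = E.
  apply/form2_bform_inj => M; rewrite -[RHS]etaE -eta_J etaE /form2.
  by rewrite -bform_mulr -bform_mull /colv !colE !mulmxA.
have omegaE C : act2 C (omega_k1 R n) =1 form2 (bform (C^T *m J^T + J^T *m C)).
  by move=> M; rewrite (eq_act2 _ (@omega_k1E R n)) act2_bform.
have muE x y : mu a A eta x y = gmu a A E x y.
  by rewrite /mu etaE form2_row_mx colv1.
(* Skewness of the Gram matrix of A^*omega is the condition under which [wedge_bform] computes its
   wedge with eta. *)
have T_skew : (A^T *m J^T + J^T *m A)^T = - (A^T *m J^T + J^T *m A).
  rewrite linearD /= !trmx_mul !trmxK J_skew !(mulmxN, mulNmx).
  by rewrite -opprD opprK addrC.
split; last first.
  rewrite (Kahler_gmu muE J_skew) /sigma_mx; split=> [/eqP | eta_eq].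
    by rewrite subr_eq0 => /eqP EE M; rewrite omegaE etaE {1}EE.
  apply/eqP; rewrite subr_eq0; apply/eqP/form2_bform_inj => M.
  by rewrite -etaE eta_eq omegaE.
rewrite (SKT_gmu muE E_skew J_skew J_sqr AJ E_J) (ddc_mx_eq0 J_skew AJ A_E).
(* By linearity in the second factor, the first SKT equation says that eta wedge sigma vanishes on
   the columns of [M]. *)
have wedgeE M : wedge eta eta M = wedge eta (act2 A (omega_k1 R n)) M <->
    bwedge E (sigma_mx A E J) (colv M 0) (colv M 1) (colv M 2) (colv M 3) = 0.
  rewrite (eq_wedge etaE etaE) (eq_wedge etaE (omegaE A)) !wedge_bform //.
  by rewrite bwedgeBr; split=> [->|/eqP]; rewrite ?subrr // subr_eq0 => /eqP.
split=> [[wedge0 ddc0] | [eta_wedge ddc0]]; split.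
- by move=> M; apply/wedgeE.
- by move=> M; rewrite omegaE ddc0 etaE /form2 bformZ.
- move=> X Y Z W.
  have := wedgeE (row_mx X (row_mx Y (row_mx Z (row_mx W (0 : 'M_(_, 0)))))
    : 'M_(_, 4)).
  by rewrite !colv_row_mxS // !colv_row_mx0 => -[+ _]; apply.
- by apply/form2_bform_inj => M; rewrite -omegaE ddc0 etaE /form2 bformZ.
Qed.
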